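(* Let $n\geq 2$ be an integer and let $(a_1,a_2,\ldots,a_n)\in(0,\infty)^n$. If $$0<a_1\leq a_2\leq\cdots\leq a_n,$$ then $$\mathrm{C}(a_1,a_2,\ldots,a_n)\leq \mathrm{C}_{*}(a_1,a_2,\ldots,a_n),$$ that is, $$\sum_{i=1}^{n-1}a_i^{a_{i+1}}+a_n^{a_1}\;\leq\;\sum_{i=1}^{n}a_i^{a_i}.$$ Moreover, equality holds if and only if $a_1=a_2=\cdots=a_n$.
   Context: For an integer $n\ge 2$ and $(a_1,\ldots,a_n)\in(0,\infty)^n$, the Cater cyclic function is $\mathrm{C}(a_1,\ldots,a_n)=\sum_{i=1}^{n}a_i^{a_{i+1}}$ with indices taken modulo $n$ (so $a_{n+1}=a_1$), i.e. $\mathrm{C}(a_1,\ldots,a_n)=\sum_{i=1}^{n-1}a_i^{a_{i+1}}+a_n^{a_1}$. The function $\mathrm{C}_{*}$ is $\mathrm{C}_{*}(a_1,\ldots,a_n)=\sum_{i=1}^{n}a_i^{a_i}$. Powers are real powers of positive reals. *)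

(* Defs.v *)
From HB Require Import structures.
From mathcomp Require Import all_boot all_order all_algebra.
From mathcomp Require Import reals exp.

Set Implicit Arguments.
Unset Strict Implicit.
Unset Printing Implicit Defensive.

Import Order.TTheory GRing.Theory Num.Theory.

Local Open Scope ring_scope.

(* Indices run over 0, ..., n-1, and [ordS i] is i + 1 modulo n, so the last
   term of the sum is a_(n-1) `^ a_0. *)
Definition cater (R : realType) (n : nat) (a : 'I_n -> R) : R :=
  \sum_(i < n) a i `^ a (ordS i).

Definition cater_star (R : realType) (n : nat) (a : 'I_n -> R) : R :=
  \sum_(i < n) a i `^ a i.

(* Main.v *)
Require Import Defs.
From mathcomp Require Import all_boot all_order all_algebra.
From mathcomp Require Import reals exp.
From mathcomp Require Import sequences ring lra.

Import Order.TTheory GRing.Theory Num.Theory.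

Local Open Scope ring_scope.

(* Write M for the largest entry a_n. Since i |-> i + 1 permutes the indices
   cyclically, the sums of M ^ a_i and of M ^ a_(i+1) agree, so C_* - C is the
   sum over i of (M ^ a_(i+1) - M ^ a_i) - (a_i ^ a_(i+1) - a_i ^ a_i). The
   term of index n vanishes, and the other ones are nonnegative, with equality
   only if a_i = a_(i+1), by the three-variable inequality
   x ^ y - x ^ x < z ^ y - z ^ x for 0 < x < y <= z. *)

(** Young's inequality for the product of x ^ r and 1, with conjugate exponents 1 / r and 1 / (1 -
    r). *)
Lemma powR_le_tangent1 (R : realType) (x r : R) :
  0 < x -> 0 < r < 1 -> x `^ r <= 1 + r * (x - 1).
Proof.
move=> x0 /andP[r0 r1].
have s0 : 0 < 1 - r by rewrite subr_gt0.
have := @conjugate_powR R (x `^ r) 1 r^-1 (1 - r)^-1.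
rewrite powR_ge0 ler01 !invr_gt0 r0 s0 !invrK -powRrM mulfV ?gt_eqF//.
rewrite (powRr1 (ltW x0)) powR1 !mulr1 mul1r => /(_ isT isT isT isT).
have -> : r + (1 - r) = 1 by ring.
move=> /(_ erefl); lra.
Qed.

(* Equivalently, the derivative of t |-> t ^ y - t ^ x is positive at t = x, so
   this function increases on [x, 1]. *)
Lemma lt_mul_powR_sub (R : realType) (x y : R) :
  0 < x -> x < y -> y < 1 -> x < y * x `^ (y - x).
Proof.
move=> x0 xy y1.
have v0 : 0 < x `^ (y - x) by exact: powR_gt0.
(* The bound for this exponent equals y - (y - x) * x, which is below y. *)
have := @powR_le_tangent1 R x (1 - (y - x)) x0.
have -> : 0 < 1 - (y - x) < 1 by apply/andP; split; lra.
move=> /(_ isT) B.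
have xE : x = x `^ (1 - (y - x)) * x `^ (y - x).
  rewrite -powRD; last by rewrite (gt_eqF x0) implybT.
  by rewrite subrK powRr1// ltW.
rewrite [ltLHS]xE ltr_pM2r//; apply: (le_lt_trans B).
have : 0 < (y - x) * x by apply: mulr_gt0 => //; lra.
lra.
Qed.

Lemma powR_diff_lt (R : realType) (x y z : R) :
  0 < x -> x < y -> y <= z -> x `^ y - x `^ x < z `^ y - z `^ x.
Proof.
move=> x0 xy yz.
have xz : x < z by exact: lt_le_trans yz.
have z0 : 0 < z by exact: lt_trans xz.
have d0 : 0 < y - x by rewrite subr_gt0.
have powE (t : R) : 0 < t -> t `^ y - t `^ x = t `^ x * (t `^ (y - x) - 1).
  move=> t0; rewrite mulrBr mulr1 -powRD; last by rewrite (gt_eqF t0) implybT.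
  by rewrite [x + _]addrC subrK.
have mono (s t p : R) : 0 < p -> 0 < s -> s < t -> s `^ p < t `^ p.
  move=> p0 s0 st; apply: gt0_ltr_powR => //; rewrite nnegrE ltW//.
  exact: lt_trans st.
rewrite !powE//.
have := mono _ _ _ d0 x0 xz; have := mono _ _ _ x0 x0 xz.
have := powR_gt0 x x0.
(* If 1 <= x, both factors t ^ x and t ^ (y - x) - 1 are nonnegative at x and larger at z. *)
have [x1|x1] := leP 1 x.
  have : 1 <= x `^ (y - x) by rewrite -(powRr0 x) ler_powR// ltW.
  nra.
have v1 : x `^ (y - x) < 1.
  by rewrite -[ltRHS](congr1 (@^~ (y - x)) (powR1 R)) mono.
(* If x < 1 <= z, the left side is negative and the right side is not. *)
have [z1|z1] := leP 1 z.
  have : 1 <= z `^ (y - x) by rewrite -(powRr0 z) ler_powR// ltW.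
  nra.
have u1 : z `^ (y - x) < 1.
  by rewrite -[ltRHS](congr1 (@^~ (y - x)) (powR1 R)) mono.
move=> xx0 _ uv.
have v0 : 0 < x `^ (y - x) by exact: powR_gt0.
have key := lt_mul_powR_sub _ _ _ x0 xy (le_lt_trans yz z1).
set L := ln z - ln x.
(* the tangent line bounds for exp at 0, applied to (z/x)^(y-x) and (x/z)^x *)
have tanu : x `^ (y - x) * (1 + (y - x) * L) <= z `^ (y - x).
  have -> : z `^ (y - x) = x `^ (y - x) * expR ((y - x) * L).
    rewrite /powR !gt_eqF// -expRD; congr expR; rewrite /L; ring.
  by rewrite ler_pM2l// expR_ge1Dx.
have tanx : z `^ x * (1 - x * L) <= x `^ x.
  have -> : x `^ x = z `^ x * expR (- (x * L)).
    rewrite /powR !gt_eqF// -expRD; congr expR; rewrite /L; ring.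
  by rewrite ler_pM2l ?powR_gt0// expR_ge1Dx.
have w0 : 0 < z `^ x by exact: powR_gt0.
have L0 : 0 < L by rewrite subr_gt0 ltr_ln ?posrE.
move: (x `^ (y - x)) (z `^ (y - x)) (x `^ x) (z `^ x)
  => v u X W in v0 u1 v1 uv key tanu tanx w0 xx0 *.
suff : W * (1 - u) < X * (1 - v) by lra.
have h1 : W * (1 - u) <= W * (1 - v * (1 + (y - x) * L)).
  rewrite ler_pM2l//; lra.
have h2 : W * (1 - x * L) * (1 - v) <= X * (1 - v).
  rewrite ler_pM2r//; lra.
apply: (le_lt_trans h1); apply: lt_le_trans h2.
rewrite -mulrA ltr_pM2l//.
(* With W cancelled, the two sides differ by exactly this product, whose second factor is positive
   by [key]. *)
have : 0 < L * (y * v - x) by apply: mulr_gt0 => //; lra.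
lra.
Qed.

(** The [leif] form carries the equality case along, so that it can be read off term by term in the
    sum. *)
Lemma powR_diff_leif (R : realType) (x y z : R) :
  0 < x -> x <= y -> y <= z ->
  x `^ y - x `^ x <= z `^ y - z `^ x ?= iff (x == y).
Proof.
move=> x0; rewrite le_eqVlt => /predU1P[<- _|xy yz].
  by rewrite !subrr eqxx; exact: leif_refl.
have lt := powR_diff_lt _ _ _ _ x0 xy yz.
by rewrite (lt_eqF xy); split; rewrite ?ltW ?lt_eqF.
Qed.

Theorem theorem1p2 (R : realType) (n : nat) (a : 'I_n -> R)
    (n_ge2 : (2 <= n)%N)
    (a_gt0 : forall i : 'I_n, 0 < a i)
    (a_nondecreasing : forall i j : 'I_n, (i <= j)%N -> a i <= a j) :
  cater a <= cater_star a /\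
  (cater a = cater_star a <-> (forall i j : 'I_n, a i = a j)).
Proof.
case: n => [//|n] in a n_ge2 a_gt0 a_nondecreasing *.
pose M := a ord_max.
pose D i := (M `^ a (ordS i) - M `^ a i) - (a i `^ a (ordS i) - a i `^ a i).
have sumD : \sum_i D i = cater_star a - cater a.
  rewrite !sumrB [X in _ - X - _](reindex_inj (@ordS_inj n.+1))/=.
  by rewrite subrr sub0r opprB.
(* The index wraps around only at [ord_max]; elsewhere monotonicity gives a_i <= a_(i+1). *)
have ordSE (i : 'I_n.+1) : i != ord_max -> ordS i = i.+1 :> nat.
  move=> im; rewrite /= modn_small// ltn_neqAle ltn_ord andbT eqSS.
  by rewrite -(inj_eq val_inj) in im.
have Dleif i : i != ord_max -> 0 <= D i ?= iff (a i == a (ordS i)).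
  move=> im; rewrite /D.
  have [le eqE] : a i `^ a (ordS i) - a i `^ a i <=
      M `^ a (ordS i) - M `^ a i ?= iff (a i == a (ordS i)).
    apply: powR_diff_leif => //; apply: a_nondecreasing.
      by rewrite ordSE.
    by rewrite -ltnS.
  by split; rewrite ?subr_ge0// eq_sym subr_eq0 eq_sym.
have D0 i : 0 <= D i.
  have [->|/Dleif[]//] := eqVneq i ord_max.
  by rewrite /D subrr.
split; first by rewrite -subr_ge0 -sumD sumr_ge0.
split=> [eqC|aE]; last by apply: eq_bigr => i _; rewrite (aE (ordS i) i).
have DE i : D i = 0.
  have sum0 : \sum_i D i = 0 by rewrite sumD eqC subrr.
  exact: (psumr_eq0P (fun i _ => D0 i) sum0).
suff a0 (i : 'I_n.+1) : a i = a ord0 by move=> i j; rewrite !a0.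
(* Induction on the index: k lies below the last index, so D_k = 0 forces a_k = a_(k+1). *)
case: i; elim=> [|k IH] kn; first by congr a; exact: val_inj.
have kn' := ltnW kn; rewrite -(IH kn').
have km : Ordinal kn' != ord_max by rewrite -(inj_eq val_inj)/= ltn_eqF.
have [_] := Dleif _ km; rewrite DE eqxx => /esym/eqP->.
by congr a; apply: val_inj; rewrite [RHS]ordSE.
Qed.
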